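(* Let $F$ be a sextic ternary form such that $\dim(P^3_F)=7$ and $Y=P^3_F\cap S$ is reduced, where $S=v_3(\mathbb{P}^2)$. Assume that $F$ has rank $9$. Then $A=v_3^{-1}(Y)$ is the unique decomposition of $F$ of length $9$, i.e. $F$ is identifiable.
   Context: Work over $\mathbb{C}$. $R=\mathbb{C}[x_0,x_1,x_2]$, and $R^\vee=\mathbb{C}[\partial_0,\partial_1,\partial_2]$ acts on $R$ by differentiation. $R_d$ and $(R^\vee)_d$ denote the degree $d$ pieces. Points of $\mathbb{P}^2=\mathbb{P}(R_1)$ are linear forms up to scalar; $v_d:\mathbb{P}^2\to\mathbb{P}(R_d)$ is the Veronese map $v_d(L)=L^d$. A (Waring) decomposition of a form $F\in R_d$ is a finite set $A=\{L_1,\dots,L_r\}\subset\mathbb{P}^2$ with $F\in\langle L_1^d,\dots,L_r^d\rangle$; its length is its cardinality $r$. The rank of $F$ is the minimal length of a decomposition of $F$; a form of rank $r$ is identifiable if it has exactly one decomposition of length $r$. For $F\in R_6$, $\mathcal{C}^3_F:(R^\vee)_3\to R_3$ is the map $D\mapsto D(F)$, $P^3_F=\mathbb{P}(\mathrm{Im}(\mathcal{C}^3_F))\subset\mathbb{P}(R_3)=\mathbb{P}^9$ is the projectivization of its image, and $\dim(P^3_F)$ is its projective dimension. The intersection $P^3_F\cap S$ is taken as a scheme.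
   Formalization: Y is additionally assumed finite: if the reduced scheme Y could contain curves the claim would fail (e.g. Y two lines and a point, F of rank 9 with infinitely many decompositions of length 9), and v_3^{-1}(Y) could never be a finite decomposition. *)

(* Defs.v *)
From HB Require Import structures.
From mathcomp Require Import all_boot all_order all_algebra.
From mathcomp Require Import bigenough finmap ssrcomplements mpoly.

Set Implicit Arguments.
Unset Strict Implicit.
Unset Printing Implicit Defensive.

Import GRing.Theory BigEnough.
Local Open Scope ring_scope.

(* P(V) is the set of lines of V, so a point is a one-dimensional subspace. *)
Notation "''P' ( V )" := {U : {vspace V} | \dim U == 1%N}
  (at level 8, format "''P' ( V )") : type_scope.

Section Proj.
Variables (K : fieldType) (V : vectType K).

(* With values in int, so that the empty projective space has dimension -1. *)
Definition projdim (U : {vspace V}) : int := (\dim U)%:Z - 1.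

Definition linear_subspace (U : {vspace V}) (p : 'P(V)) : Prop := (val p <= U)%VS.

(* The homogeneous coordinate ring Sym(V^* ) of P(V), written in the
   coordinates attached to the basis vbasis {:V}. *)
Definition coord_ring := {mpoly K[\dim {:V}]}.

Definition evalv (f : coord_ring) (v : V) : K :=
  f.@[fun i => coord (vbasis {:V}) i v].

(* A closed subscheme of P(V) is represented by a homogeneous ideal defining
   it; ideals are written as predicates. *)
Definition subscheme := coord_ring -> Prop.

(* The reduced closed subscheme carried by a set X of points: the polynomials
   vanishing on the affine cone over X. *)
Definition ideal_of (X : 'P(V) -> Prop) : subscheme :=
  fun f => forall p, X p -> forall v, v \in val p -> evalv f v = 0.

Definition points (J : subscheme) (p : 'P(V)) : Prop :=
  forall f, J f -> forall v, v \in val p -> evalv f v = 0.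

(* Over an algebraically closed field a closed subscheme of P(V) is finite,
   i.e. of dimension at most 0, exactly when it has finitely many closed points. *)
Definition finite_scheme (J : subscheme) : Prop :=
  exists A : {fset 'P(V)}, forall p, points J p -> p \in A.

(* The scheme-theoretic intersection is defined by the sum of the ideals. *)
Definition scheme_inter (I J : subscheme) : subscheme :=
  fun f => exists g h, [/\ I g, J h & f = g + h].

(* The ideal of the trace of J on the standard affine chart X_i != 0, whose
   coordinate ring is coord_ring / (J + (X_i - 1)). *)
Definition chart (i : 'I_(\dim {:V})) (J : subscheme) : subscheme :=
  fun f => exists g h : coord_ring, J g /\ f = g + h * ('X_i - 1).

Definition radical_ideal (J : subscheme) : Prop :=
  forall (f : coord_ring) (k : nat), J (f ^+ k) -> J f.

(* A scheme is reduced when the coordinate rings of the members of an affine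
   open cover have no nonzero nilpotent. *)
Definition reduced_scheme (J : subscheme) : Prop :=
  forall i, radical_ideal (chart i J).

End Proj.

Section Forms.
Variables (K : fieldType) (n : nat).

Local Notation "''R_' d" := (dhomog n.+1 K d) (at level 8, d at level 2).

(* A polynomial D in the dual variables, read as a differential operator with
   constant coefficients. *)
Definition diffop (D F : {mpoly K[n.+1]}) : {mpoly K[n.+1]} :=
  \sum_(m <- msupp D) D@_m *: mderivm m F.

Lemma dhomog_mderiv d i (p : {mpoly K[n.+1]}) :
  p \is d.-homog -> mderiv i p \is d.-1.-homog.
Proof.
move=> hp; rewrite /mderiv big_seq rpred_sum // => m mp.
have dm : mdeg m = d by move/dhomogP: hp => /(_ _ mp).
have [mi0|mi0] := eqVneq (m i) 0%N; first by rewrite mi0 mulr0n mul0r scale0r dhomog0.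
apply/dhomogZ; rewrite dhomogX; apply/eqP => /=.
have le1 : (U_(i) <= m)%MM by rewrite lep1mP.
by rewrite -dm -{2}(submK le1) mdegD mdeg1 addn1.
Qed.

Lemma dhomog_mderivm d m (p : {mpoly K[n.+1]}) :
  p \is d.-homog -> mderivm m p \is (d - mdeg m).-homog.
Proof.
move=> hp; rewrite mderivm_foldr /= -size_m2s /m2s.
elim: flatten => [|i s ih] /=; first by rewrite subn0.
by rewrite subnS; apply: dhomog_mderiv.
Qed.

Lemma dhomog_diffop d k (D : 'R_k) (F : 'R_d) :
  diffop D F \is (d - k).-homog.
Proof.
rewrite /diffop big_seq rpred_sum // => m mD; apply/dhomogZ.
have <- : mdeg m = k by move/dhomogP: (dhomog_is_dhomog D) => /(_ _ mD).
exact/dhomog_mderivm/dhomog_is_dhomog.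
Qed.

(* For k > d the form D(F) is 0 and the truncated degree d - k is harmless. *)
Definition catalecticant_fun d k (F : 'R_d) (D : 'R_k) : 'R_(d - k) :=
  DHomog (dhomog_diffop D F).

Lemma diffop_is_linear F : linear (diffop^~ F).
Proof.
have diffopE k (D : {mpoly K[n.+1]}) : (msize D <= k)%N ->
    diffop D F = \sum_(m : 'X_{1..n.+1 < k}) D@_m *: mderivm m F.
  pose I : subFinType _ := 'X_{1..n.+1 < k}.
  move=> le_Dk; rewrite /diffop (big_mksub I) /=; first last.
  - by move=> x /msize_mdeg_lt/leq_trans/(_ le_Dk).
  - by rewrite msupp_uniq.
  rewrite big_rmcond //= => i.
  by move/memN_msupp_eq0 ->; rewrite scale0r.
move=> c p q; pose_big_enough j; first rewrite !(diffopE j) //.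
  rewrite scaler_sumr -big_split /=; apply: eq_bigr => m _.
  by rewrite mcoeffD mcoeffZ scalerDl scalerA.
by close.
Qed.

Lemma catalecticant_is_linear d k (F : 'R_d) : linear (@catalecticant_fun d k F).
Proof. by move=> c D E; apply: val_inj; rewrite /= diffop_is_linear. Qed.

HB.instance Definition _ d k (F : 'R_d) :=
  GRing.isLinear.Build K 'R_k 'R_(d - k) _ (@catalecticant_fun d k F)
    (@catalecticant_is_linear d k F).

Definition catalecticant d k (F : 'R_d) : 'Hom('R_k, 'R_(d - k)) :=
  linfun (@catalecticant_fun d k F).

Lemma catalecticantE d k (F : 'R_d) (D : 'R_k) :
  catalecticant k F D = diffop D F :> {mpoly K[n.+1]}.
Proof. by rewrite lfunE. Qed.

Lemma dhomog_formX d (L : 'R_1) : (L : {mpoly K[n.+1]}) ^+ d \is d.-homog.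
Proof. by rewrite -{2}[d]mul1n; apply/dhomogMn/dhomog_is_dhomog. Qed.

Definition formX d (L : 'R_1) : 'R_d := DHomog (dhomog_formX d L).

Lemma dim_veronese d (p : 'P('R_1)) : \dim <[formX d (vpick (val p))]>%VS == 1%N.
Proof.
have p0 : vpick (val p) != 0 by rewrite vpick0 -dimv_eq0 (eqP (valP p)).
rewrite dim_vline; suff -> : formX d (vpick (val p)) != 0 by [].
apply: contraNneq p0 => /(congr1 val)/eqP /=.
by rewrite expf_eq0 => /andP[_ /eqP p0]; apply/eqP/val_inj.
Qed.

(* veroneseE below: the value does not depend on the representative vpick. *)
Definition veronese d (p : 'P('R_1)) : 'P('R_d) :=
  exist _ <[formX d (vpick (val p))]>%VS (dim_veronese d p).

Lemma veroneseE d (p : 'P('R_1)) (L : 'R_1) :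
  L \in val p -> L != 0 -> val (veronese d p) = <[formX d L]>%VS.
Proof.
move=> Lp L0; rewrite /=; set M := vpick _.
have pL : (val p = <[L]>)%VS.
  apply/eqP; rewrite eq_sym eqEdim -memvE Lp dim_vline L0.
  by rewrite (eqP (valP p)).
have /vlineP[c Mc] : M \in <[L]>%VS by rewrite -pL memv_pick.
have M0 : M != 0 by rewrite /M vpick0 -dimv_eq0 (eqP (valP p)).
have c0 : c != 0 by apply: contraNneq M0 => c0; rewrite Mc c0 scale0r.
have -> : formX d M = c ^+ d *: formX d L.
  by apply: val_inj; rewrite /= Mc exprZn.
apply/eqP; rewrite eqEsubv -!memvE memvZ ?memv_line //=.
apply/vlineP; exists (c ^- d); rewrite scalerA mulVf ?scale1r //.
exact: expf_neq0.
Qed.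

Definition veronese_variety d (q : 'P('R_d)) : Prop :=
  exists p, q = veronese d p.

Definition decomposition d (F : 'R_d) (A : {fset 'P('R_1)}) : Prop :=
  F \in (\sum_(p <- A) val (veronese d p))%VS.

Definition waring_rank d (F : 'R_d) (r : nat) : Prop :=
  (exists A, decomposition F A /\ #|` A| = r) /\
  (forall A, decomposition F A -> (r <= #|` A|)%N).

Definition identifiable d (F : 'R_d) : Prop :=
  exists r, waring_rank F r /\ exists! A, decomposition F A /\ #|` A| = r.

End Forms.

Arguments catalecticant {K n d} k F.
Arguments veronese {K n} d p.
Arguments veronese_variety {K n} d q.

(* Main.v *)
From HB Require Import structures.
Require Import Defs.
From mathcomp Require Import all_boot all_order all_algebra.
From mathcomp Require Import perm ssrcomplements finmap mpoly reals complex.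
From mathcomp Require Import boolp ring zify.

Set Implicit Arguments.
Unset Strict Implicit.
Unset Printing Implicit Defensive.

Import GRing.Theory Num.Theory.
Local Open Scope ring_scope.

(** Write [C] for the catalecticant of [F] and [P] for its image.  The argument
    compares an arbitrary decomposition of length 9 with the set of all points
    [L] such that [L^3] lies in [P], and shows that the two coincide.

    Let [F] be the sum of [c_i L_i^6] over nine points; every [c_i] is nonzero,
    since the rank is 9.  A cubic operator [D] sends [F] to the sum of
    [120 c_i D(L_i) L_i^3], so [P] is contained in the span of the nine cubes.
    If the cubes are dependent, their span has dimension at most 8, hence equals
    [P].  If they are independent, apolarity supplies operators [D_i] dual to
    them, and [C(D_i)] is a nonzero multiple of [L_i^3].  In both cases every
    [L_i^3] lies in [P] ([powers_in_catalecticant]).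

    On the other hand [P] is the annihilator of the kernel of [C]: a cube [L^3]
    lies in [P] exactly when every cubic in the kernel vanishes at [L]
    ([base_locus]).  This rests on the perfectness of the apolarity pairing
    ([apolar_repr]), which turns linear functionals on forms into operators.
    Since the cubics form a space of dimension 10, the kernel is a pencil,
    spanned by two plane cubics with finitely many common points, and by the
    inequality of Bezout ([bezout]) there are at most 9 of them
    ([base_points_le9]).  So the nine points of any decomposition of length 9
    exhaust the base locus of the pencil, which depends on [F] only.

    The inequality of Bezout is proved by elimination: after projecting from a
    general point, the common points give distinct roots of a resultant, whose
    degree is bounded by weighing the entries of the Sylvester matrix
    ([size_resultant_le]), and which vanishes identically only if there are
    infinitely many common points. *)

(** * Polynomials are determined by their values *)

Section ChainRule.
Variables (K : fieldType) (n : nat) (a : 'I_n -> K) (i : 'I_n).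

Definition along_axis (p : {mpoly K[n]}) : {poly K} :=
  mmap polyC (fun j => (a j)%:P + (j == i)%:R *: 'X) p.

Lemma horner_along_axis p s :
  (along_axis p).[s] = p.@[fun j => a j + (j == i)%:R * s].
Proof.
rewrite /along_axis /meval /mmap horner_sum; apply: eq_bigr => m _.
rewrite hornerM hornerC /mmap1 horner_prod; congr (_ * _).
by apply: eq_bigr => j _; rewrite horner_exp !hornerE.
Qed.

(** The chain rule along a coordinate axis, proved by closing the property under
    products and starting from the variables. *)
Lemma deriv_along_axis p : (along_axis p)^`() = along_axis p^`M(i).
Proof.
pose Q p := (along_axis p)^`() = along_axis p^`M(i).
have QM q r : Q q -> Q r -> Q (q * r).
  rewrite /Q /along_axis => Qq Qr.
  by rewrite mderivM rmorphM derivM Qq Qr rmorphD !rmorphM.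
have Q1 : Q 1 by rewrite /Q /along_axis rmorph1 derivC -mpolyC1 mderivC rmorph0.
have QX j : Q 'X_j.
  rewrite /Q /along_axis mderivX mmapX mmap1U mnm1E derivD derivC add0r derivZ.
  rewrite derivX mmapZ mmapX; case: eqP => [->|_]; last first.
    by rewrite scale0r mul0r.
  rewrite (_ : (U_(i) - U_(i))%MM = 0%MM) ?mmap11 ?scale1r ?mulr1 //.
  by apply/mnmP => k; rewrite mnmBE subnn mnm0E.
elim/mpolyind: p => [|c m p _ _ IHp].
  by rewrite /along_axis mderiv0 !rmorph0 deriv0.
rewrite -/(Q _) in IHp.
have QXm : Q 'X_[m].
  rewrite mpolyXE_id; elim/big_ind: _ => // j _.
  by elim: (m j) => [|k IHk]; rewrite ?expr0 // exprS; apply: QM.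
rewrite -/(Q _) /Q mderivD mderivZ.
rewrite /along_axis !rmorphD derivD -/(along_axis p) IHp; congr (_ + _).
by rewrite /= !mmapZ derivM derivC mul0r add0r -/(along_axis _) QXm.
Qed.

End ChainRule.

(** The partial derivative at [a] is the linear coefficient of the restriction to
    a line through [a], and that restriction has infinitely many roots. *)
Lemma meval_mderiv_eq0 (K : numFieldType) n (p : {mpoly K[n]}) (i : 'I_n) :
  (forall a, p.@[a] = 0) -> forall a, p^`M(i).@[a] = 0.
Proof.
move=> p0 a.
have q0 : along_axis a i p = 0.
  apply/eqP/negPn/negP => q0.
  pose rs : seq K := [seq k%:R | k <- iota 0 (size (along_axis a i p))].
  have := max_poly_roots (rs := rs) q0.
  rewrite map_inj_uniq ?iota_uniq; last by move=> x y /eqP; rewrite eqr_nat => /eqP.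
  rewrite size_map size_iota ltnn => /(_ _ isT) h.
  suff: false by []. apply: h; apply/allP => x _.
  by rewrite /root horner_along_axis p0.
have : (along_axis a i p)^`().[0] = 0 by rewrite q0 deriv0 horner0.
rewrite deriv_along_axis horner_along_axis => <-; apply: meval_eq => j.
by rewrite mulr0 addr0.
Qed.

Lemma mcoeff0_mderivm (R : ringType) n (p : {mpoly R[n]}) m :
  (p^`M[m])@_0 = p@_m *+ (\prod_(i < n) (m i)`!).
Proof.
rewrite mcoeff_mderivm addm0; congr (_ *+ _); apply: eq_bigr => i _.
by rewrite ffactnn.
Qed.

Lemma meval_at0 (R : comRingType) n (p : {mpoly R[n]}) : p.@[fun=> 0] = p@_0.
Proof.
elim/mpolyind: p => [|c m p _ _ IH]; first by rewrite meval0 mcoeff0.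
rewrite mevalD mcoeffD IH mevalZ mcoeffZ mevalX mcoeffX; congr (_ * _ + _).
have [->|/eqP m0] := eqP; first by rewrite big1 // => i _; rewrite mnm0E expr0.
have [i mi] : exists i, m i != 0%N.
  apply/existsP; apply: contraR m0; rewrite negb_exists => /forallP mi0.
  by apply/eqP/mnmP => i; rewrite mnm0E; apply/eqP/negPn/mi0.
by rewrite (bigD1 i) //= expr0n (negbTE mi) mul0r.
Qed.

(** All iterated derivatives vanish at the origin, and these are the coefficients
    up to factorials, which are invertible in characteristic 0. *)
Lemma meval_eq0 (K : numFieldType) n (p : {mpoly K[n]}) :
  (forall a, p.@[a] = 0) -> p = 0.
Proof.
move=> p0; apply/mpolyP => m; rewrite mcoeff0.
have pm a : (p^`M[m]).@[a] = 0.
  rewrite mderivm_foldr /=; elim: (flatten _) a => [|i s IH] a /=; first exact: p0.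
  exact: meval_mderiv_eq0.
have /eqP := mcoeff0_mderivm p m; rewrite -meval_at0 pm eq_sym mulrn_eq0.
case/orP => [|/eqP //]; rewrite -leqn0 leqNgt prodn_gt0 // => i.
exact: fact_gt0.
Qed.

(** * Apolarity *)

Section Apolarity.
Variables (K : numFieldType) (n : nat).
Local Notation "''R_' d" := (dhomog n.+1 K d) (at level 8, d at level 2).
Implicit Types (D E F p : {mpoly K[n.+1]}) (m : 'X_{1..n.+1}).

(** A linear form read as a point of the space on which the dual variables are
    coordinates. *)
Definition dual_coords (L : 'R_1) : 'I_n.+1 -> K := fun i => L@_U_(i).

Lemma dhomog_coeff0 d (G : 'R_d) m : mdeg m != d -> G@_m = 0.
Proof. exact: dhomog_nemf_coeff (dhomog_is_dhomog G). Qed.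

Lemma mderiv_linear_form (L : 'R_1) i : L^`M(i) = (dual_coords L i)%:MP.
Proof.
apply/mpolyP => m; rewrite mcoeff_mderiv mcoeffC.
have [->|/eqP m0] := eqP; first by rewrite add0m mnm0E mulr1.
rewrite mulr0 dhomog_coeff0 ?mul0rn //.
by rewrite mdegD mdeg1 addn1 eqSS mdeg_eq0.
Qed.

Lemma mderiv_formX (L : 'R_1) i d :
  ((L : {mpoly K[n.+1]}) ^+ d)^`M(i) = (d%:R * dual_coords L i) *: (L : {mpoly K[n.+1]}) ^+ d.-1.
Proof.
elim: d => [|d IH]; first by rewrite expr0 -mpolyC1 mderivC mul0r scale0r.
rewrite exprS mderivM IH mderiv_linear_form mul_mpolyC.
case: d {IH} => [|d]; first by rewrite !mul0r scale0r mulr0 addr0 mul1r.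
rewrite -scalerAr -exprS -scalerDl /=; congr (_ *: _).
by rewrite [in RHS]mulrSr mulrDl mul1r addrC.
Qed.

Lemma mderivm_formX (L : 'R_1) m d :
  ((L : {mpoly K[n.+1]}) ^+ d)^`M[m] =
  ((d ^_ mdeg m)%:R * 'X_[m].@[dual_coords L]) *: (L : {mpoly K[n.+1]}) ^+ (d - mdeg m).
Proof.
have -> : 'X_[m].@[dual_coords L] = \prod_(i <- m2s m) dual_coords L i.
  rewrite mevalX big_flatten /= big_map enumT /index_enum.
  by apply: eq_bigr => i _; rewrite big_nseq iter_mulr mulr1.
rewrite mderivm_foldr /= -/(m2s m) -size_m2s.
elim: (m2s m) => [|i s IH] /=.
  by rewrite big_nil subn0 mulr1 ffactn0 scale1r.
rewrite IH mderivZ mderiv_formX scalerA subnS ffactnSr big_cons natrM.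
by congr (_ *: _); ring.
Qed.

(** The dictionary between operators and points: each derivation multiplies a
    power of [L] by a coordinate of [L], so an operator acts through its value. *)
Lemma diffop_formX (L : 'R_1) k (D : 'R_k) d :
  diffop D ((L : {mpoly K[n.+1]}) ^+ d) =
  ((d ^_ k)%:R * D.@[dual_coords L]) *: (L : {mpoly K[n.+1]}) ^+ (d - k).
Proof.
rewrite {2}(mpolyE D) raddf_sum /= mulr_sumr scaler_suml /diffop.
apply: eq_big_seq => m mD.
have mk : mdeg m = k by apply: (dhomog_mf (dhomog_is_dhomog D) mD).
by rewrite mderivm_formX mk mevalZ scalerA; congr (_ *: _); ring.
Qed.

Lemma diffop_is_linearr D : linear (diffop D).
Proof.
move=> c p q; rewrite /diffop scaler_sumr -big_split; apply: eq_bigr => m _ /=.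
by rewrite linearP scalerDr !scalerA mulrC.
Qed.

HB.instance Definition _ D :=
  GRing.isLinear.Build K {mpoly K[n.+1]} {mpoly K[n.+1]} _ (diffop D)
    (diffop_is_linearr D).

Lemma diffopX m F : diffop 'X_[m] F = F^`M[m].
Proof. by rewrite /diffop msuppX big_seq1 mcoeffX eqxx scale1r. Qed.

Lemma diffopC D E F : diffop D (diffop E F) = diffop E (diffop D F).
Proof.
rewrite {1 3}/diffop; under eq_bigr do rewrite linear_sum scaler_sumr /=.
rewrite exchange_big /=; apply: eq_bigr => m _.
rewrite linear_sum scaler_sumr /=; apply: eq_bigr => m' _.
by rewrite !linearZ /= !scalerA mulrC -!mderivmDm addmC.
Qed.

Lemma dhomog0_const p : p \is 0.-homog -> p = (p@_0%MM)%:MP.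
Proof.
move=> hp; apply/mpolyP => m; rewrite mcoeffC.
have [->|/eqP m0] := eqP; first by rewrite mulr1.
by rewrite mulr0 (dhomog_nemf_coeff hp) // mdeg_eq0.
Qed.

(** The operators given by monomials read off the coefficients of [G]. *)
Lemma diffop_nondeg d (G : 'R_d) : (forall D : 'R_d, diffop D G = 0) -> G = 0.
Proof.
move=> G0; apply/val_inj/mpolyP => m; rewrite /= mcoeff0.
have [md|md] := eqVneq (mdeg m) d; last exact: dhomog_coeff0.
have hm : 'X_[K, m] \is d.-homog by rewrite dhomogX; apply/eqP.
have := mcoeff0_mderivm G m.
rewrite -diffopX (G0 (DHomog hm)) mcoeff0 => /esym/eqP.
rewrite mulrn_eq0 => /orP[|/eqP //].
by rewrite -leqn0 leqNgt prodn_gt0 // => i; apply: fact_gt0.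
Qed.

Definition apolar_form d (D G : 'R_d) : K^o := (diffop D G)@_0%MM.

Lemma diffop_apolar d (D G : 'R_d) : diffop D G = (apolar_form D G)%:MP.
Proof. by apply: dhomog0_const; have := dhomog_diffop D G; rewrite subnn. Qed.

(** In the monomial basis the pairing is diagonal, with factorials as entries. *)
Lemma apolar_formC d (D G : 'R_d) : apolar_form D G = apolar_form G D.
Proof.
rewrite /apolar_form.
have E (A B : 'R_d) : (diffop A B)@_0%MM =
    \sum_(m : 'X_{1..n.+1 < d.+1}) A@_m * (B@_m *+ (\prod_(i < n.+1) (m i)`!)).
  transitivity (\sum_(m <- msupp A) A@_m * (B@_m *+ (\prod_(i < n.+1) (m i)`!))).
    rewrite raddf_sum; apply: eq_bigr => m _ /=.
    by rewrite mcoeffZ mcoeff0_mderivm.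
  pose I : subFinType _ := 'X_{1..n.+1 < d.+1}.
  rewrite (big_mksub I) /=; first last.
  - move=> m mA; rewrite ltnS.
    by rewrite (dhomog_mf (dhomog_is_dhomog A) mA).
  - exact: msupp_uniq.
  by rewrite big_rmcond // => m /memN_msupp_eq0->; rewrite mul0r.
by rewrite !E; apply: eq_bigr => m _; rewrite mulrnAr -mulrnAl mulrC.
Qed.

Lemma apolar_is_linear d (D : 'R_d) : linear (apolar_form D).
Proof.
move=> c G H; rewrite /apolar_form.
by rewrite !linearP.
Qed.

HB.instance Definition _ d (D : 'R_d) :=
  GRing.isLinear.Build K 'R_d K^o _ (apolar_form D) (apolar_is_linear D).

Definition apolar_functional d (D : 'R_d) : 'Hom('R_d, K^o) :=
  linfun (apolar_form D).

Lemma apolar_functional_is_linear d : linear (@apolar_functional d).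
Proof.
move=> c D E; apply/lfunP => G; rewrite !lfunE /= !lfunE /=.
by rewrite apolar_formC linearP /= !(apolar_formC G) lfunE.
Qed.

HB.instance Definition _ d :=
  GRing.isLinear.Build K 'R_d 'Hom('R_d, K^o) _ (@apolar_functional d)
    (@apolar_functional_is_linear d).

(** The pairing is perfect: its left kernel is trivial by symmetry and
    [diffop_nondeg], and a finite-dimensional space and its dual have the same
    dimension. *)
Lemma apolar_repr d (phi : 'Hom('R_d, K^o)) :
  exists D : 'R_d, forall G : 'R_d, apolar_form D G = phi G.
Proof.
pose f := linfun (@apolar_functional d).
have kf : lker f == 0%VS.
  apply/lker0P => D E; rewrite !lfunE /= => DE.
  apply/eqP; rewrite -subr_eq0; apply/eqP/diffop_nondeg => G.
  rewrite diffop_apolar linearB /= -!(apolar_formC _ G).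
  have := congr1 (fun h : 'Hom(_, _) => h G) DE.
  by rewrite !lfunE /= => ->; rewrite subrr.
have : phi \in limg f.
  have -> : limg f = fullv; last exact: memvf.
  by apply/eqP; rewrite eqEdim subvf limg_dim_eq ?(eqP kf) ?capv0 // !dimvf /dim /= muln1.
by case/memv_imgP => D _ ->; exists D => G; rewrite lfunE /= lfunE.
Qed.

End Apolarity.

(** * Degree and roots of a resultant *)

Section ResultantDegree.
Variables (K : fieldType).
Implicit Types p q : {poly {poly K}}.

(** When the coefficient of degree [k] of [p] has degree at most [deg p - k], the
    entry [(i, j)] of the Sylvester matrix has degree at most [w i - j] for some
    row weight [w].  A nonzero term of the determinant uses each column once, so
    its degree is at most the sum of the row weights minus that of the column
    indices, which is the product of the degrees. *)
Lemma size_resultant_le p q :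
  (forall k, (size (p`_k)%R <= size p - k)%N) ->
  (forall k, (size (q`_k)%R <= size q - k)%N) ->
  (size (resultant p q) <= ((size p).-1 * (size q).-1).+1)%N.
Proof.
move=> wp wq; rewrite /resultant /determinant.
set dp := (size p).-1; set dq := (size q).-1.
pose w (i : 'I_(dq + dp)) : nat :=
  match split i with inl k => (dp + k)%N | inr k => (dq + k)%N end.
have wM i j : Sylvester_mx p q i j != 0 ->
    (size (Sylvester_mx p q i j) + j <= (w i).+1)%N.
  have aux (r : {poly {poly K}}) k : (forall l, (size (r`_l)%R <= size r - l)%N) ->
      r`_(j - k) *+ (k <= j)%N != 0 ->
      (size (r`_(j - k) *+ (k <= j)%N)%R + j <= ((size r).-1 + k).+1)%N.
    move=> wr; case: leqP => [kj|_]; last by rewrite mulr0n eqxx.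
    by rewrite mulr1n -size_poly_gt0; have := wr (j - k)%N; lia.
  by rewrite Sylvester_mxE /w; case: (split i) => k; apply: aux.
have sum_w : (\sum_i w i = dq * dp + \sum_(i < dq + dp) i)%N.
  rewrite !big_split_ord /= /w.
  under eq_bigr do rewrite (unsplitK (inl _)).
  under [X in (_ + X)%N]eq_bigr do rewrite (unsplitK (inr _)).
  by rewrite big_split /= sum_nat_const card_ord addnA.
apply: leq_trans (size_sum _ _ _) _; apply/bigmax_leqP => s _.
set P := \prod_i _.
rewrite mulr_sign; have [->|P0] := eqVneq P 0; first by rewrite oppr0 if_same size_poly0.
rewrite (fun_if (fun r : {poly K} => size r)) size_polyN if_same.
have nz i : Sylvester_mx p q i (s i) != 0.
  by apply: contraNneq P0 => M0; rewrite /P (bigD1 i) //= M0 mul0r.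
rewrite size_prod //.
rewrite (_ : #|_| = (dq + dp)%N); last by rewrite -[RHS]card_ord; apply: eq_card.
have : (\sum_i (size (Sylvester_mx p q i (s i)) + s i) <= \sum_i (w i).+1)%N.
  by apply: leq_sum => i _; apply: wM.
rewrite big_split /=.
have -> : (\sum_i (s i : nat) = \sum_(i < dq + dp) i)%N.
  by rewrite [RHS](reindex_inj (@perm_inj _ s)).
have -> : (\sum_i (w i).+1 = \sum_i w i + (dq + dp))%N.
  under eq_bigr do rewrite -addn1.
  by rewrite big_split /= sum_nat_const card_ord muln1.
rewrite sum_w addnAC leq_add2r mulnC leq_subLR => le_sum.
by rewrite addnS ltnS [leqRHS]addnC.
Qed.

End ResultantDegree.

(** The condition on leading coefficients makes the resultant commute with
    specialisation at [t]. *)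
Lemma root_resultant (K : closedFieldType) (p q : {poly {poly K}}) t :
  (lead_coef p).[t] != 0 -> (lead_coef q).[t] != 0 ->
  root (resultant p q) t <-> exists z, p.[z%:P].[t] = 0 /\ q.[z%:P].[t] = 0.
Proof.
move=> lp lq; rewrite /root.
have -> : (resultant p q).[t] =
    resultant (map_poly (horner_eval t) p) (map_poly (horner_eval t) q).
  by rewrite -map_resultant.
rewrite resultant_eq0; set P := map_poly _ p; set Q := map_poly _ q.
have hz (r : {poly {poly K}}) z : (map_poly (horner_eval t) r).[z] = r.[z%:P].[t].
  by rewrite -[RHS](horner_map (horner_eval t)) /= /horner_eval hornerC.
have P0 : P != 0.
  apply: contraNneq lp => P0; have := coef0 K (size p).-1.
  by rewrite -P0 coef_map => /eqP.
have G0 : gcdp P Q != 0 by rewrite gcdp_eq0 negb_and P0.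
split=> [s1|[z [pz qz]]].
  have /closed_rootP[z] : size (gcdp P Q) != 1%N by rewrite neq_ltn s1 orbT.
  by rewrite root_gcd /root !hz => /andP[/eqP pz /eqP qz]; exists z.
have: root (gcdp P Q) z by rewrite root_gcd /root !hz pz qz eqxx.
by move/root_size_gt1; apply.
Qed.

(** * Affine charts of homogeneous polynomials *)

Section Weights.
Variable K : fieldType.
Implicit Types P Q : {poly {poly K}}.

(** The shape of a dehomogenised form of degree [d], seen as a polynomial in [z]
    over the polynomials in [t]: total degree at most [d], and the coefficient of
    [z ^ d] is the constant [c]. *)
Definition weighted d P (c : K) : Prop :=
  (forall k, (size (P`_k)%R <= d.+1 - k)%N) /\ P`_d = c%:P.

Lemma weighted0 d : weighted d 0 0.
Proof. by split=> [k|]; rewrite coef0 ?size_poly0. Qed.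

Lemma weightedD d P Q a b :
  weighted d P a -> weighted d Q b -> weighted d (P + Q) (a + b).
Proof.
move=> [wP Pd] [wQ Qd]; split=> [k|]; last by rewrite coefD Pd Qd polyCD.
by rewrite coefD (leq_trans (size_polyD _ _)) // geq_max wP wQ.
Qed.

Lemma weightedC a : weighted 0 a%:P%:P a.
Proof.
split=> [k|]; last by rewrite coefC.
rewrite coefC; case: k => [|k] /=; last by rewrite size_poly0.
exact: size_polyC_leq1.
Qed.

Lemma weightedM d e P Q a b :
  weighted d P a -> weighted e Q b -> weighted (d + e) (P * Q) (a * b).
Proof.
move=> [wP Pd] [wQ Qd].
have P0 k : (d < k)%N -> P`_k = 0.
  move=> dk; apply/eqP; rewrite -size_poly_eq0 -leqn0.
  by apply: leq_trans (wP k) _; rewrite leqn0 subn_eq0.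
have Q0 k : (e < k)%N -> Q`_k = 0.
  move=> ek; apply/eqP; rewrite -size_poly_eq0 -leqn0.
  by apply: leq_trans (wQ k) _; rewrite leqn0 subn_eq0.
split=> [k|].
  rewrite coefM; apply: leq_trans (size_sum _ _ _) _; apply/bigmax_leqP => j _.
  have [dj|jd] := ltnP d j; first by rewrite P0 // mul0r size_poly0.
  have [ekj|kje] := ltnP e (k - j)%N; first by rewrite Q0 // mulr0 size_poly0.
  apply: leq_trans (size_polyMleq _ _) _.
  have := wP j; have := wQ (k - j)%N; have := ltn_ord j; lia.
have dde : (d < (d + e).+1)%N by rewrite ltnS leq_addr.
rewrite coefM (bigD1 (Ordinal dde)) //= addKn Pd Qd polyCM big1 ?addr0 // => j jd.
have [dj|] := ltnP d j; first by rewrite P0 // mul0r.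
rewrite leq_eqVlt => /orP[/eqP dj|jd']; first by case/eqP: jd; apply: val_inj.
by rewrite Q0 ?mulr0 //; lia.
Qed.

Lemma weightedX d P a k : weighted d P a -> weighted (d * k) (P ^+ k) (a ^+ k).
Proof.
move=> wP; elim: k => [|k IH]; first by rewrite muln0 !expr0; apply: weightedC.
by rewrite mulnS !exprS; apply: weightedM.
Qed.

Lemma size_weighted d P a : weighted d P a -> a != 0 -> size P = d.+1.
Proof.
move=> [wP Pd] a0; apply/eqP; rewrite eqn_leq; apply/andP; split.
  apply/leq_sizeP => k dk; apply/eqP; rewrite -size_poly_eq0 -leqn0.
  by apply: leq_trans (wP k) _; rewrite leqn0 subn_eq0.
rewrite ltnNge; apply: contra a0 => /leq_sizeP/(_ d (leqnn d)).
by rewrite Pd => /eqP; rewrite polyC_eq0.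
Qed.

Lemma lead_coef_weighted d P a : weighted d P a -> a != 0 -> lead_coef P = a%:P.
Proof. by move=> wP a0; rewrite /lead_coef (size_weighted wP a0); case: wP. Qed.

End Weights.

Section Projection.
Variables (K : fieldType) (n : nat) (u v q : 'rV[K]_n).

(** The restriction of [p] to the points [u + t v + z q], as a polynomial in [z]
    with coefficients in [t]; projecting from [q] forgets [z]. *)
Definition affine_chart (p : {mpoly K[n]}) : {poly {poly K}} :=
  mmap (polyC \o polyC)
    (fun i => ((u 0 i)%:P + v 0 i *: 'X)%:P + (q 0 i)%:P *: 'X) p.

Lemma horner_affine_chart p z t :
  (affine_chart p).[z%:P].[t] = p.@[(u + t *: v + z *: q) 0].
Proof.
rewrite /affine_chart /meval /mmap horner_sum horner_sum; apply: eq_bigr => m _.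
rewrite !hornerM !hornerC /mmap1 !horner_prod; congr (_ * _).
apply: eq_bigr => j _; rewrite !horner_exp !hornerE !mxE /=.
by rewrite [v 0 j * t]mulrC [q 0 j * z]mulrC.
Qed.

(** The leading coefficient in [z] is the value at the centre of projection, so it
    is a nonzero constant when the curve does not pass through [q]. *)
Lemma weighted_affine_chart d (D : dhomog n K d) :
  weighted d (affine_chart D) (D : {mpoly K[n]}).@[q 0].
Proof.
rewrite mevalE /affine_chart /mmap big_seq [X in weighted _ _ X]big_seq.
elim/big_rec2: _ => [|m P c mD wc]; first exact: weighted0.
apply: weightedD; last exact: wc.
have md : mdeg m = d by exact: (dhomog_mf (dhomog_is_dhomog D) mD).
suff wm : weighted (mdeg m) (mmap1 (fun i =>
    ((u 0 i)%:P + v 0 i *: 'X)%:P + (q 0 i)%:P *: 'X) m) (\prod_i q 0 i ^+ m i).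
  by rewrite md in wm; apply: (weightedM (weightedC _) wm).
rewrite mdegE /mmap1.
elim/big_rec3: _ => [|i k P' c' _ wc']; first exact: weightedC.
apply: weightedM wc'; rewrite -[X in weighted X]mul1n; apply: weightedX.
split=> [k'|].
  rewrite coefD coefC coefZ coefX; case: k' => [|[|k']] /=.
  - rewrite mulr0 addr0 (leq_trans (size_polyD _ _)) // geq_max.
    rewrite (leq_trans (size_polyC_leq1 _)) //=.
    by rewrite (leq_trans (size_scale_leq _ _)) // size_polyX.
  - by rewrite add0r mulr1 size_polyC_leq1.
  - by rewrite mulr0 addr0 size_poly0.
by rewrite coefD coefC coefZ coefX /= add0r mulr1.
Qed.

End Projection.

(** * General position and the inequality of Bezout *)

Section GeneralPosition.
Variable K : numFieldType.

Lemma nonvanishing_point n (p : {mpoly K[n]}) :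
  p != 0 -> exists x : 'rV[K]_n, p.@[x 0] != 0.
Proof.
move=> p0; apply/not_existsP => h; move/eqP: p0; apply.
apply: meval_eq0 => a; apply/eqP/negPn/negP => pa.
apply: (h (\row_i a i)); congr (_ != _): pa.
by apply: meval_eq => i; rewrite mxE.
Qed.

Definition linear_poly n (c : 'cV[K]_n) : {mpoly K[n]} :=
  \sum_i c i 0 *: 'X_i.

Lemma meval_linear_poly n (c : 'cV[K]_n) (x : 'rV[K]_n) :
  (linear_poly c).@[x 0] = (x *m c) 0 0.
Proof.
rewrite /linear_poly raddf_sum mxE /=; apply: eq_bigr => i _.
by rewrite mevalZ mevalXU mulrC.
Qed.

Lemma mcoeff_linear_poly n (c : 'cV[K]_n) i : (linear_poly c)@_U_(i) = c i 0.
Proof.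
rewrite /linear_poly raddf_sum (bigD1 i) //= mcoeffZ mcoeffXU eqxx mulr1.
by rewrite big1 ?addr0 // => j ji; rewrite mcoeffZ mcoeffXU (negbTE ji) mulr0.
Qed.

Lemma linear_poly_eq0 n (c : 'cV[K]_n) : (linear_poly c == 0) = (c == 0).
Proof.
apply/eqP/eqP => [c0|->]; last first.
  by rewrite /linear_poly big1 // => i _; rewrite mxE scale0r.
by apply/colP => i; rewrite [RHS]mxE -mcoeff_linear_poly c0 mcoeff0.
Qed.

(** An equation of a line through [a] and [b]: [x] is on it when
    [x *m line_through a b = 0].  For proportional [a] and [b] it is some line
    through that point. *)
Definition line_through (a b : 'rV[K]_3) : 'cV[K]_3 :=
  (nz_row (kermx (col_mx a b)^T))^T.

Lemma line_through_neq0 a b : line_through a b != 0.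
Proof.
rewrite /line_through -[0]trmx0 (inj_eq trmx_inj) nz_row_eq0 -mxrank_eq0.
by rewrite mxrank_ker subn_eq0 -ltnNge ltnS mxrank_tr rank_leq_row.
Qed.

Lemma line_throughP a b : a *m line_through a b = 0 /\ b *m line_through a b = 0.
Proof.
have /sub_kermxP : (nz_row (kermx (col_mx a b)^T) <= kermx (col_mx a b)^T)%MS.
  exact: nz_row_sub.
move=> /(congr1 trmx); rewrite trmx_mul trmxK trmx0 -/(line_through a b).
rewrite mul_col_mx -[0]vsubmxK => /eq_col_mx[-> ->].
by split; apply/matrixP => i j; rewrite !mxE.
Qed.

(** A product of nonzero polynomials is nonzero, so one point avoids them all. *)
Lemma off_line_point (r : seq 'cV[K]_3) (p : {mpoly K[3]}) :
  p != 0 -> {in r, forall c, c != 0} ->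
  exists x : 'rV[K]_3, p.@[x 0] != 0 /\ {in r, forall c, x *m c != 0}.
Proof.
move=> p0 r0; have : p * \prod_(c <- r) linear_poly c != 0.
  rewrite mulf_neq0 // prodf_seq_neq0; apply/allP => c /r0 c0 /=.
  by rewrite linear_poly_eq0.
move/nonvanishing_point => [x]; rewrite mevalM mulf_eq0 negb_or => /andP[px].
rewrite rmorph_prod prodf_seq_neq0 => /allP rx; exists x; split=> // c /rx /=.
by rewrite meval_linear_poly; apply: contra => /eqP->; rewrite mxE.
Qed.

End GeneralPosition.

Lemma meval_dhomogZ (K : fieldType) n d (D : dhomog n K d) c (x : 'rV[K]_n) :
  (D : {mpoly K[n]}).@[(c *: x) 0] = c ^+ d * (D : {mpoly K[n]}).@[x 0].
Proof.
rewrite !mevalE mulr_sumr; apply: eq_big_seq => m mD.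
have md : mdeg m = d by exact: (dhomog_mf (dhomog_is_dhomog D) mD).
rewrite mulrCA -[X in c ^+ X]md mdegE; congr (_ * _).
rewrite -prodrXr -big_split; apply: eq_bigr => i _ /=.
by rewrite mxE exprMn.
Qed.

Lemma free2 (K : fieldType) (V : vectType K) (a b : V) :
  free [:: a; b] = (a \notin <[b]>%VS) && (b != 0).
Proof. by rewrite free_cons span_seq1 seq1_free. Qed.

(** The points of [s] are to become distinct roots of a resultant after projection
    from [q], so [q] has to avoid every line through two of them.  The polynomial
    [p] will be the product of two curves, so that [q] lies on neither.  Once [q]
    is chosen, [v] places the line at infinity, through [v] and [q], away from
    [s]. *)
Lemma general_position (K : numFieldType) (p : {mpoly K[3]}) (s : seq 'rV[K]_3) :
  p != 0 -> 0 \notin s ->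
  exists v q : 'rV[K]_3, [/\ p.@[q 0] != 0,
    {in s &, forall a b, q *m line_through a b != 0} &
    {in s, forall a x y z, x *: a + y *: v + z *: q = 0 ->
       [/\ x = 0, y = 0 & z = 0]}].
Proof.
move=> p0 s0; pose L := @line_through K.
have [q [pq qL]] : exists q : 'rV[K]_3, p.@[q 0] != 0 /\
    {in [seq L a b | a <- s, b <- s], forall c, q *m c != 0}.
  apply: off_line_point => // _ /allpairsP[[a b] [_ _ ->]].
  exact: line_through_neq0.
have {}qL a b : a \in s -> b \in s -> q *m L a b != 0.
  by move=> sa sb; apply: qL; apply/allpairsP; exists (a, b).
have [v [_ vL]] : exists v : 'rV[K]_3, (1 : {mpoly K[3]}).@[v 0] != 0 /\
    {in [seq L a q | a <- s], forall c, v *m c != 0}.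
  apply: off_line_point; first exact: oner_neq0.
  by move=> _ /mapP[a _ ->]; apply: line_through_neq0.
exists v, q; split=> // a sa x y z h.
have y0 : y = 0.
  have := congr1 (mulmx^~ (L a q)) h; rewrite !mulmxDl mul0mx -!scalemxAl.
  have [-> ->] := line_throughP a q; rewrite !scaler0 add0r addr0 => /eqP.
  by rewrite scaler_eq0 (negbTE (vL _ (map_f _ sa))) orbF => /eqP.
have z0 : z = 0.
  (* The pair [(a, a)] was among those used to choose [q]. *)
  have := congr1 (mulmx^~ (L a a)) h; rewrite y0 scale0r addr0.
  rewrite !mulmxDl mul0mx -!scalemxAl; have [-> _] := line_throughP a a.
  rewrite scaler0 add0r => /eqP.
  by rewrite scaler_eq0 (negbTE (qL _ _ sa sa)) orbF => /eqP.
split=> //; move: h; rewrite y0 z0 !scale0r !addr0 => /eqP.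
by rewrite scaler_eq0 => /orP[/eqP//|/eqP a0]; rewrite -a0 sa in s0.
Qed.

Lemma affine_coordinates (K : fieldType) (u v q a : 'rV[K]_3) :
  (forall x y z, x *: u + y *: v + z *: q = 0 -> [/\ x = 0, y = 0 & z = 0]) ->
  (forall x y z, x *: a + y *: v + z *: q = 0 -> [/\ x = 0, y = 0 & z = 0]) ->
  exists x t z, x != 0 /\ a = x *: (u + t *: v + z *: q).
Proof.
move=> uP aP; have fr : free [:: u; v; q].
  apply/freeP => /= k; rewrite !big_ord_recl big_ord0 addr0 /= addrA => h.
  have [k0 k1 k2] := uP _ _ _ h.
  case=> [[|[|[|i]]]] //= hi; [rewrite -[RHS]k0 | rewrite -[RHS]k1 | rewrite -[RHS]k2];
    by congr (k _); apply: val_inj.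
have /span_basis sp : basis_of fullv [:: u; v; q].
  by rewrite basisEfree fr subvf dimvf /dim.
have : a \in <<[:: u; v; q]>>%VS by rewrite sp memvf.
rewrite !span_cons span_nil addv0 => /memv_addP[_ /vlineP[x ->]].
case=> _ /memv_addP[_ /vlineP[y ->] [_ /vlineP[z ->] ->]] aE.
have x0 : x != 0.
  apply/eqP => x0; have [] := aP 1 (- y) (- z); last by move/eqP; rewrite oner_eq0.
  by rewrite aE x0 scale0r add0r scale1r !scaleNr addrAC addrK addrN.
exists x, (y / x), (z / x); split=> //.
rewrite aE !scalerDr !scalerA [x * (y / x)]mulrC [x * (z / x)]mulrC !mulfVK //.
by rewrite addrA.
Qed.

(** The inequality of Bezout, in contrapositive form: two plane curves of degrees
    [d] and [e] with more than [d * e] common points have infinitely many.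
    In the coordinates given by [general_position], eliminating [z] gives a
    resultant of degree at most [d * e] in [t] with more roots than that, so it is
    identically zero, and above every [t] there is a common point. *)
Lemma bezout (K : numClosedFieldType) d e (D : dhomog 3 K d) (E : dhomog 3 K e)
    (s : seq 'rV[K]_3) :
  D != 0 -> E != 0 -> uniq s -> 0 \notin s ->
  {in s &, forall a b, a != b -> free [:: a; b]} ->
  {in s, forall a : 'rV[K]_3,
    (D : {mpoly K[3]}).@[a 0] = 0 /\ (E : {mpoly K[3]}).@[a 0] = 0} ->
  (d * e < size s)%N ->
  exists f : K -> 'rV[K]_3,
    (forall t t', t != t' -> free [:: f t; f t']) /\
    forall t, (D : {mpoly K[3]}).@[f t 0] = 0 /\ (E : {mpoly K[3]}).@[f t 0] = 0.
Proof.
move=> D0 E0 us s0 sind sDE des.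
have [u su] : exists u, u \in s.
  by case: (s) des => // u s' _; exists u; rewrite mem_head.
have DE0 : (D : {mpoly K[3]}) * (E : {mpoly K[3]}) != 0 by exact: mulf_neq0.
have [v [q [DEq qL coord0]]] := general_position DE0 s0.
move: DEq; rewrite mevalM mulf_eq0 negb_or => /andP[Dq Eq].
pose pt t z := u + t *: v + z *: q.
have [w wP] : {w : 'rV[K]_3 -> K * K * K | forall a, a \in s ->
    (w a).1.1 != 0 /\ a = (w a).1.1 *: pt (w a).1.2 (w a).2}.
  apply: cid; suff /choice[w wP] : forall a, exists w : K * K * K, a \in s ->
      w.1.1 != 0 /\ a = w.1.1 *: pt w.1.2 w.2 by exists w.
  move=> a; have [sa|sa] := boolP (a \in s); last by exists (0, 0, 0).
  by have [x [t [z h]]] := affine_coordinates (coord0 u su) (coord0 a sa); exists (x, t, z).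
have wD := weighted_affine_chart u v q D.
have wE := weighted_affine_chart u v q E.
set P := affine_chart u v q D in wD; set Q := affine_chart u v q E in wE.
have lP t : (lead_coef P).[t] != 0 by rewrite (lead_coef_weighted wD) ?hornerC.
have lQ t : (lead_coef Q).[t] != 0 by rewrite (lead_coef_weighted wE) ?hornerC.
have res0 : resultant P Q = 0.
  apply/eqP/negPn/negP => r0.
  have := @max_poly_roots _ _ [seq (w a).1.2 | a <- s] r0.
  (* Two points of [s] above the same [t] would lie on a line through [q]. *)
  rewrite map_inj_in_uniq => [|a b sa sb tab]; last first.
    apply/eqP/negPn/negP => ab.
    have [x0 aE] := wP a sa; have [y0 bE] := wP b sb.
    have zab : (w a).2 = (w b).2.
      pose L := line_through a b; have [La Lb] := line_throughP a b.
      have wL c : c \in [:: a; b] ->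
          (w c).1.1 != 0 /\ c = (w c).1.1 *: pt (w c).1.2 (w c).2 ->
          pt (w c).1.2 (w c).2 *m L = 0.
        move=> cab [c0 cE]; have : c *m L = 0.
          by move: cab; rewrite !inE => /orP[] /eqP->.
        rewrite {1}cE -scalemxAl => /eqP.
        by rewrite scaler_eq0 (negbTE c0) => /eqP.
      have h : pt (w a).1.2 (w a).2 *m L = pt (w b).1.2 (w b).2 *m L.
        by rewrite !wL ?inE ?eqxx ?orbT //; apply: wP.
      move: h; rewrite tab /pt !mulmxDl => /addrI /eqP.
      rewrite -subr_eq0 -mulmxBl -scalerBl -scalemxAl scaler_eq0.
      by rewrite (negbTE (qL _ _ sa sb)) orbF subr_eq0 => /eqP.
    have := sind _ _ sa sb ab; rewrite free2 => /andP[/negP ab0 _].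
    apply: ab0; apply/vlineP; exists ((w a).1.1 / (w b).1.1).
    by rewrite {2}bE scalerA mulfVK // -tab -zab.
  rewrite us size_map => /(_ _ isT) h.
  have : (size s < size (resultant P Q))%N.
    apply: h; apply/allP => _ /mapP[a sa ->].
    apply/root_resultant => //; exists (w a).2.
    have [x0 aE] := wP a sa; have [Da Ea] := sDE a sa.
    have hom k (G : dhomog 3 K k) : (G : {mpoly K[3]}).@[a 0] = 0 ->
        (G : {mpoly K[3]}).@[(pt (w a).1.2 (w a).2) 0] = 0.
      rewrite {1}aE meval_dhomogZ => /eqP.
      by rewrite mulf_eq0 expf_eq0 (negbTE x0) andbF => /eqP.
    by rewrite !horner_affine_chart; split; apply: hom.
  rewrite ltnNge => /negP[]; apply: leq_trans des.
  have sP := size_weighted wD Dq; have sQ := size_weighted wE Eq.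
  have := @size_resultant_le K P Q; rewrite sP sQ; apply.
    by case: wD.
  by case: wE.
have zP t : exists z,
    (D : {mpoly K[3]}).@[pt t z 0] = 0 /\ (E : {mpoly K[3]}).@[pt t z 0] = 0.
  have : root (resultant P Q) t by rewrite res0 root0.
  move/root_resultant => [] // z; rewrite !horner_affine_chart => hz.
  by exists z.
have [z zPP] := choice zP.
exists (fun t => pt t (z t)); split=> // t t' tt'; rewrite free2; apply/andP; split.
  apply/vlineP => -[k h]; case/eqP: tt'.
  have [k1 tk _] : [/\ 1 - k = 0, t - k * t' = 0 & z t - k * z t' = 0].
    apply: (coord0 u su); apply/eqP; rewrite -(subrr (pt t (z t))) {2}h /pt.
    apply/eqP/rowP => i; rewrite !mxE; ring.
  move/eqP: k1; rewrite subr_eq0 => /eqP k1.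
  by move/eqP: tk; rewrite -k1 mul1r subr_eq0 => /eqP.
apply/eqP => h.
have [] := coord0 _ su 1 t' (z t'); last by move/eqP; rewrite oner_eq0.
by rewrite scale1r.
Qed.

(** * Closed points of an intersection *)

Section Subschemes.
Variables (K : fieldType) (V : vectType K).
Implicit Types (U : {vspace V}) (I J : subscheme V) (q : 'P(V)).

(** Project along [U] and pick a nonzero coordinate. *)
Lemma separating_functional U x :
  x \notin U -> exists phi : 'Hom(V, K^o), {in U, forall y, phi y = 0} /\ phi x != 0.
Proof.
move=> xU; pose h : 'End(V) := (\1 - projv U)%VF.
have hx : h x != 0.
  apply: contra xU; rewrite add_lfunE opp_lfunE id_lfunE subr_eq0 => /eqP->.
  exact: memv_proj.
have /existsP[i hxi] : [exists i, coord (vbasis fullv) i (h x) != 0].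
  rewrite -negb_forall; apply: contra hx => /forallP h0.
  rewrite (coord_vbasis (memvf (h x))) big1 // => i _.
  by rewrite (eqP (h0 i)) scale0r.
exists (linfun (coord (vbasis fullv) i : V -> K^o) \o h)%VF.
split=> [y yU|]; last by rewrite comp_lfunE lfunE.
by rewrite comp_lfunE lfunE /= add_lfunE opp_lfunE id_lfunE projv_id // subrr linear0.
Qed.

Lemma evalvD (g h : coord_ring V) x : evalv (g + h) x = evalv g x + evalv h x.
Proof. exact: mevalD. Qed.

Lemma evalv_linear_form (phi : 'Hom(V, K^o)) :
  exists f : coord_ring V, forall x, evalv f x = phi x.
Proof.
exists (\sum_(i < \dim {:V}) (phi (vbasis {:V})`_i : K) *: 'X_i) => x.
rewrite {2}(coord_vbasis (memvf x)) /evalv linear_sum raddf_sum /=.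
by apply: eq_bigr => i _; rewrite mevalZ mevalXU linearZ /= mulrC.
Qed.

Lemma ideal_of0 (X : 'P(V) -> Prop) : ideal_of X 0.
Proof. by move=> p _ x _; rewrite /evalv meval0. Qed.

Lemma points_scheme_inter I J q : I 0 -> J 0 ->
  points (scheme_inter I J) q <-> points I q /\ points J q.
Proof.
move=> I0 J0; split=> [h|[hI hJ] _ [g [h [Ig Jh ->]]] x xq].
  by split=> f hf; apply: h; [exists f, 0 | exists 0, f]; rewrite ?addr0 ?add0r.
by rewrite evalvD (hI g) // (hJ h) // addr0.
Qed.

Lemma points_ideal_of (X : 'P(V) -> Prop) q : X q -> points (ideal_of X) q.
Proof. by move=> Xq f Xf; apply: Xf. Qed.

(** A vector outside [U] is detected by a linear equation of [U]. *)
Lemma points_linear_subspace U q :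
  points (ideal_of (linear_subspace U)) q <-> (val q <= U)%VS.
Proof.
split=> [h|]; last exact: points_ideal_of.
apply/subvP => x xq; apply/negPn/negP => xU.
have [phi [phiU /negP]] := separating_functional xU; apply.
have [f fE] := evalv_linear_form phi.
rewrite -fE (h f) // => p pU y yp; rewrite fE phiU //.
by move/subvP: pU; apply.
Qed.

End Subschemes.

(** * Points and powers of linear forms *)

Section Veronese.
Variables (K : numFieldType) (n : nat).
Local Notation "''R_' d" := (dhomog n.+1 K d) (at level 8, d at level 2).
Implicit Types (p : 'P('R_1)) (L M : 'R_1).

Lemma mpoly_of_dhomog_inj d : injective (@mpoly_of_dhomog n.+1 K d).
Proof. exact: val_inj. Qed.

(** A derivation killing [M] but not [L] kills [M ^ d.+1] but not [L ^ d.+1]. *)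
Lemma formX_notin d L M :
  L \notin <[M]>%VS -> formX d.+1 L \notin <[formX d.+1 M]>%VS.
Proof.
move=> LM; have [phi [phiM phiL]] := separating_functional LM.
have [D DE] := apolar_repr phi.
have ev N : phi N = D.@[dual_coords N].
  rewrite -DE /apolar_form -(expr1 (N : {mpoly K[n.+1]})) diffop_formX subnn expr0.
  by rewrite mcoeffZ mcoeff1 eqxx mulr1 ffactn1 mul1r.
have /eqP DM := phiM M (memv_line M); rewrite ev in DM; rewrite ev in phiL.
apply/vlineP => -[c /(congr1 (fun G : 'R_d.+1 => diffop D G))] /=.
rewrite linearZ /= !diffop_formX (eqP DM) mulr0 scale0r scaler0 => /eqP.
rewrite scaler_eq0 mulf_eq0 (negbTE phiL) orbF ffactn1 pnatr_eq0 /=.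
rewrite subn1 expf_eq0 => /andP[_ /eqP L0]; case/negP: LM.
suff -> : L = 0 by apply: mem0v.
by apply/mpoly_of_dhomog_inj; rewrite L0 linear0.
Qed.

Lemma point_eq_line p : val p = <[vpick (val p)]>%VS.
Proof.
apply/eqP; rewrite eq_sym eqEdim -memvE memv_pick (eqP (valP p)).
by rewrite dim_vline vpick0 -dimv_eq0 (eqP (valP p)).
Qed.

Lemma vpick_point_neq0 p : vpick (val p) != 0.
Proof. by rewrite vpick0 -dimv_eq0 (eqP (valP p)). Qed.

Lemma line_point_subproof L : L != 0 -> \dim <[L]>%VS == 1%N.
Proof. by rewrite dim_vline => ->. Qed.

Definition line_point L (L0 : L != 0) : 'P('R_1) :=
  exist _ <[L]>%VS (line_point_subproof L0).

Lemma veronese_inj d : injective (@veronese K n d.+1).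
Proof.
move=> p q /(congr1 val) /= pq; apply/val_inj; rewrite (point_eq_line p) (point_eq_line q).
have mem L M : <[formX d.+1 L]>%VS = <[formX d.+1 M]>%VS -> (<[L]> <= <[M]>)%VS.
  move=> ab; rewrite -memvE; apply/negPn/negP => h; have := formX_notin d h; rewrite -ab.
  by rewrite memv_line.
by apply/eqP; rewrite eqEsubv !mem.
Qed.

Lemma dual_coords_inj L M : dual_coords L =1 dual_coords M -> L = M.
Proof.
move=> LM; apply/val_inj/mpolyP => m /=.
have [/eqP m1|m1] := eqVneq (mdeg m) 1%N; last by rewrite !dhomog_coeff0.
by move: m1; rewrite mdeg_eq1 => /existsP[i /eqP->]; apply: LM.
Qed.

(** Linear forms as row vectors, the shape in which [bezout] takes points. *)
Definition row_of L : 'rV[K]_n.+1 := \row_i dual_coords L i.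

Lemma meval_row_of (D : {mpoly K[n.+1]}) L : D.@[row_of L 0] = D.@[dual_coords L].
Proof. by apply: meval_eq => i; rewrite mxE. Qed.

Lemma row_ofZ c L : row_of (c *: L) = c *: row_of L.
Proof. by apply/rowP => i; rewrite !mxE /dual_coords mcoeffZ. Qed.

Lemma row_of_inj : injective row_of.
Proof.
move=> L M LM; apply: dual_coords_inj => i.
by have := congr1 (fun x : 'rV_n.+1 => x 0 i) LM; rewrite !mxE.
Qed.

Lemma row_of_surj (x : 'rV[K]_n.+1) : exists L, row_of L = x.
Proof.
have h : linear_poly x^T \is 1.-homog.
  by rewrite rpred_sum // => i _; rewrite rpredZ // dhomogX /= mdeg1.
exists (DHomog h); apply/rowP => i.
by rewrite mxE /dual_coords /= mcoeff_linear_poly mxE.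
Qed.

End Veronese.

(** * Waring decompositions and the catalecticant *)

Section Decompositions.
Variables (K : numFieldType) (n : nat).
Local Notation "''R_' d" := (dhomog n.+1 K d) (at level 8, d at level 2).
Implicit Types (p : 'P('R_1)) (A B : {fset 'P('R_1)}).

Local Notation rep p := (vpick (val (p : 'P('R_1)))).

Lemma decomposition_sum d (F : 'R_d) A : decomposition F A ->
  exists c : 'I_#|` A| -> K,
    F = \sum_i c i *: formX d (rep (tnth (in_tuple A) i)).
Proof.
rewrite /decomposition big_tnth => /memv_sumP[G GL ->].
have [c cG] : exists c : 'I_#|` A| -> K,
    forall i, G i = c i *: formX d (rep (tnth (in_tuple A) i)).
  apply: (fin_all_exists (U := fun=> K) (P := fun i k => G i = k *: _)) => i.
  by apply/vlineP; apply: GL.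
by exists c; apply: eq_bigr => i _; rewrite cG.
Qed.

Lemma veronese_sub_sum d A (p : 'P('R_1)) : p \in A ->
  (val (veronese d p) <= \sum_(q <- A) val (veronese d q))%VS.
Proof. by move=> pA; rewrite (big_fsetD1 p) //= addvSl. Qed.

(** A term with zero coefficient could be dropped, giving a shorter
    decomposition. *)
Lemma minimal_decomposition_neq0 d (F : 'R_d) A (c : 'I_#|` A| -> K) :
  waring_rank F #|` A| ->
  F = \sum_i c i *: formX d (rep (tnth (in_tuple A) i)) -> forall i, c i != 0.
Proof.
move=> [_ Fmin] FE i; apply/eqP => ci0.
pose q := tnth (in_tuple A) i.
have qA : q \in A by apply: mem_tnth.
have : decomposition F (A `\ q)%fset.
  rewrite /decomposition FE; apply: memv_suml => j _.
  have [->|ji] := eqVneq j i; first by rewrite ci0 scale0r mem0v.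
  apply: memvZ; rewrite memvE; apply: (@veronese_sub_sum d _ (tnth (in_tuple A) j)).
  have tA : tnth (in_tuple A) j \in A by exact: mem_tnth.
  apply/fsetD1P; split=> //; apply: contraNneq ji; rewrite /q => /eqP.
  by rewrite !(tnth_nth q) /= nth_uniq ?fset_uniq.
move=> /Fmin; rewrite (cardfsD1 q A) qA add1n ltnn //.
Qed.

End Decompositions.

Section Sextics.
Variables (K : numFieldType) (n : nat).
Local Notation "''R_' d" := (dhomog n.+1 K d) (at level 8, d at level 2).
Variable F : 'R_6.
Let P3F : {vspace 'R_3} := limg (catalecticant 3 F).

Lemma apolar_formX3 (L : 'R_1) (D : 'R_3) :
  apolar_form D (formX 3 L) = 6%:R * D.@[dual_coords L].
Proof. by rewrite /apolar_form /= diffop_formX mcoeffZ mcoeff1 eqxx mulr1. Qed.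

Lemma catalecticant_power_sum r (c : 'I_r -> K) (L : 'I_r -> 'R_1) (D : 'R_3) :
  F = \sum_i c i *: formX 6 (L i) ->
  catalecticant 3 F D =
  \sum_i (120%:R * c i * D.@[dual_coords (L i)]) *: formX 3 (L i) :> 'R_3.
Proof.
move=> FE; apply: mpoly_of_dhomog_inj; rewrite (catalecticantE F D) FE !raddf_sum /=.
apply: eq_bigr => i _.
by rewrite !linearZ /= diffop_formX scalerA (_ : 6 ^_ 3 = 120)%N //; congr (_ *: _); ring.
Qed.

(** Either the cubes of the [L i] are independent, and the operator dual to the
    [i]-th cube maps [F] to a multiple of it; or they span a space of dimension at
    most [r.-1], which by the hypothesis on the rank is all of the image. *)
Lemma powers_in_catalecticant r (c : 'I_r -> K) (L : 'I_r -> 'R_1) :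
  F = \sum_i c i *: formX 6 (L i) -> (forall i, c i != 0) ->
  (r <= (\dim P3F).+1)%N -> forall i, formX 3 (L i) \in P3F.
Proof.
move=> FE c0 rF i; pose X := [tuple formX 3 (L i) | i < r].
have Xnth (j : 'I_r) : X`_j = formX 3 (L j) by rewrite -tnth_nth tnth_mktuple.
have [fX|nfX] := boolP (free X).
  have [D DE] := apolar_repr (linfun (coord X i : 'R_3 -> K^o)).
  have ev j : 6%:R * D.@[dual_coords (L j)] = (j == i)%:R.
    by rewrite -apolar_formX3 DE lfunE /= -Xnth coord_free // eq_sym.
  have : catalecticant 3 F D \in P3F by apply: memv_img; apply: memvf.
  rewrite (catalecticant_power_sum D FE) (bigD1 i) //= big1 ?addr0 => [|j ji].
    move=> /(memvZ (120%:R * c i * D.@[dual_coords (L i)])^-1).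
    rewrite scalerA mulVf ?scale1r // !mulf_neq0 ?pnatr_eq0 //.
    have := ev i; rewrite eqxx => /eqP; apply: contraTneq => ->.
    by rewrite mulr0 eq_sym oner_eq0.
  have := ev j; rewrite (negbTE ji) => /eqP.
  by rewrite mulf_eq0 pnatr_eq0 /= => /eqP->; rewrite mulr0 scale0r.
have PX : (P3F <= <<X>>)%VS.
  apply/subvP => _ /memv_imgP[D _ ->].
  rewrite (catalecticant_power_sum D FE); apply: memv_suml => j _.
  by apply/memvZ/memv_span; rewrite -Xnth mem_nth // size_tuple.
have -> : P3F = <<X>>%VS.
  apply/eqP; rewrite eqEdim PX /= -ltnS (leq_trans _ rF) //.
  rewrite -[X in (_ < X)%N](size_tuple X) ltn_neqAle dim_span andbT.
  exact: nfX.
by rewrite -Xnth memv_span // mem_nth // size_tuple.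
Qed.

(** The catalecticant is symmetric for the apolarity pairing, so its image is the
    annihilator of its kernel. *)
Lemma base_locus (L : 'R_1) :
  formX 3 L \in P3F <->
  forall E : 'R_3, E \in lker (catalecticant 3 F) -> E.@[dual_coords L] = 0.
Proof.
have kerE (E : 'R_3) : (E \in lker (catalecticant 3 F)) = (diffop E F == 0).
  rewrite memv_ker -(catalecticantE F E); apply/eqP/eqP => [->|EF0].
    by rewrite linear0.
  by apply: mpoly_of_dhomog_inj; rewrite EF0 linear0.
split=> [/memv_imgP[D _ LE] E|vL].
  rewrite kerE => /eqP EF; have : apolar_form E (formX 3 L) = 0.
    by rewrite /apolar_form LE (catalecticantE F D) diffopC EF linear0 mcoeff0.
  by rewrite apolar_formX3 => /eqP; rewrite mulf_eq0 pnatr_eq0 => /eqP.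
apply/negPn/negP => /separating_functional[phi [phiP]].
have [E EE] := apolar_repr phi; rewrite -EE apolar_formX3 vL ?mulr0 ?eqxx //.
rewrite kerE; apply/eqP.
suff : catalecticant 3 F E = 0.
  by move/(congr1 (@mpoly_of_dhomog n.+1 K 3)); rewrite (catalecticantE F E) linear0.
apply: diffop_nondeg => D; rewrite (catalecticantE F E) diffopC -(catalecticantE F D).
by rewrite diffop_apolar EE phiP ?mpolyC0 // memv_img // memvf.
Qed.

End Sextics.

(** * Ternary sextics *)

Lemma dim2_pair (K : fieldType) (V : vectType K) (U : {vspace V}) :
  \dim U = 2%N -> exists x y, free [:: x; y] /\ U = <<[:: x; y]>>%VS.
Proof.
move=> U2; have bU := vbasisP U; have := size_tuple (vbasis U).
rewrite [RHS]U2; case: (tval _) bU => [|x [|y []]] // bU _.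
exists x, y; split; first exact: basis_free bU.
by rewrite (span_basis bU).
Qed.

Lemma dim_cubics (K : fieldType) : \dim {: dhomog 3 K 3} = 10%N.
Proof. by rewrite dimvf. Qed.

Section TernarySextics.
Variable K : numClosedFieldType.
Local Notation "''R_' d" := (dhomog 3 K d) (at level 8, d at level 2).
Variable F : 'R_6.
Let P3F : {vspace 'R_3} := limg (catalecticant 3 F).

(** The kernel of the catalecticant is a pencil of cubics, and the points in
    question are its base points.  More than 9 of them would give a family of base
    points indexed by [K], hence more than [S] can hold. *)
Lemma base_points_le9 (S : {fset 'P('R_3)}) (ps : seq 'P('R_1)) :
  \dim P3F = 8%N ->
  (forall p, (val (veronese 3 p) <= P3F)%VS -> veronese 3 p \in S) ->
  uniq ps -> {in ps, forall p, (val (veronese 3 p) <= P3F)%VS} ->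
  (size ps <= 9)%N.
Proof.
move=> dP finP ups psP; rewrite leqNgt; apply/negP => ps10.
have kerF2 : \dim (lker (catalecticant 3 F)) = 2%N.
  have := limg_ker_dim (catalecticant 3 F) fullv.
  by rewrite capfv -/P3F dP dim_cubics; apply: (@addIn 8 _ 2).
have [D [E [frDE kerE]]] := dim2_pair kerF2.
move: frDE; rewrite free2 => /andP[DE E0].
have D0 : D != 0 by apply: contraNneq DE => ->; rewrite mem0v.
have kerP (L : 'R_1) : formX 3 L \in P3F <->
    D.@[dual_coords L] = 0 /\ E.@[dual_coords L] = 0.
  apply: iff_trans (base_locus F L) _; rewrite kerE span_cons span_seq1.
  split=> [h|[DL EL] _ /memv_addP[_ /vlineP[x ->] [_ /vlineP[y ->] ->]]].
    split; apply: h; first by apply: (subvP (addvSl _ _)); apply: memv_line.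
    by apply: (subvP (addvSr _ _)); apply: memv_line.
  by rewrite /= mevalD !mevalZ DL EL !mulr0 addr0.
pose s : seq 'rV[K]_3 := [seq row_of (vpick (val p)) | p <- ps].
have row_line (p q : 'P('R_1)) :
    row_of (vpick (val p)) \in <[row_of (vpick (val q))]>%VS -> p = q.
  case/vlineP => k; rewrite -row_ofZ => /row_of_inj pq.
  apply: val_inj; rewrite (point_eq_line p) (point_eq_line q).
  apply/eqP; rewrite eqEdim !dim_vline !vpick_point_neq0 andbT -memvE.
  by rewrite pq memvZ ?memv_line.
have row0 (L : 'R_1) : L != 0 -> row_of L != 0.
  apply: contraNneq => L0; apply/eqP/row_of_inj.
  by rewrite L0 -(scale0r (0 : 'R_1)) row_ofZ scale0r.
have [f [ffree fDE]] : exists f : K -> 'rV[K]_3,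
    (forall t t', t != t' -> free [:: f t; f t']) /\
    forall t, (D : {mpoly K[3]}).@[f t 0] = 0 /\ (E : {mpoly K[3]}).@[f t 0] = 0.
  apply: (@bezout K 3 3 D E s) => //.
  - rewrite map_inj_uniq // => p q pq; apply: row_line; rewrite pq.
    exact: memv_line.
  - apply/mapP => -[p _ p0]; have := row0 _ (vpick_point_neq0 p).
    by rewrite -p0 eqxx.
  - move=> _ _ /mapP[p _ ->] /mapP[q _ ->] pq; rewrite free2.
    rewrite row0 ?vpick_point_neq0 // andbT.
    by apply: contra pq => /row_line->.
  - by move=> _ /mapP[p pps ->]; rewrite !meval_row_of; apply/kerP/psP.
  - by rewrite size_map.
have [g gf] := choice (fun t => row_of_surj (f t)).
have g0 t : g t != 0.
  have : free [:: f (t + 1); f t].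
    by apply: ffree; rewrite -subr_eq0 addrAC subrr add0r oner_neq0.
  rewrite free2 => /andP[_]; apply: contraNneq => gt0.
  by rewrite -gf gt0 -(scale0r (0 : 'R_1)) row_ofZ scale0r.
pose pt t := line_point (g0 t).
have ptP t : veronese 3 (pt t) \in S.
  apply: finP; rewrite (@veroneseE K 2 3 (pt t) (g t)) ?memv_line // -memvE.
  by apply/kerP; rewrite -!meval_row_of gf.
have pt_inj : injective pt.
  move=> t t' /(congr1 val) /= tt'; apply/eqP/negPn/negP => /ffree.
  rewrite free2 -!gf => /andP[/negP + _]; apply.
  have /vlineP[k ->] : g t \in <[g t']>%VS by rewrite -tt' memv_line.
  by rewrite row_ofZ memvZ ?memv_line.
(* One more base point than the cardinality of [S]. *)
pose qs := [seq veronese 3 (pt k%:R) | k <- iota 0 #|` S|.+1].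
have uqs : uniq qs.
  rewrite map_inj_uniq ?iota_uniq // => i j /(@veronese_inj K 2 2) /pt_inj /eqP.
  by rewrite eqr_nat => /eqP.
have : {subset qs <= S} by move=> _ /mapP[k _ ->].
by move=> /(uniq_leq_size uqs); rewrite size_map size_iota ltnn.
Qed.

Lemma decomposition_in_base_locus A :
  \dim P3F = 8%N -> waring_rank F 9 -> decomposition F A -> #|` A| = 9%N ->
  {in A, forall p, (val (veronese 3 p) <= P3F)%VS}.
Proof.
move=> dP rF /decomposition_sum[c FE] cA p pA.
have c0 : forall i, c i != 0.
  by apply: (minimal_decomposition_neq0 _ FE); rewrite cA.
have := powers_in_catalecticant FE c0; rewrite -/P3F dP [X in (X <= _)%N]cA => /(_ isT).
have /tnthP[i ->] : p \in in_tuple A by [].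
exact.
Qed.

End TernarySextics.

(** The Veronese variety contains the points [veronese d p], so only the linear
    subspace imposes a condition on them. *)
Lemma points_inter_veronese (K : fieldType) n d (U : {vspace dhomog n.+1 K d}) p :
  points (scheme_inter (ideal_of (linear_subspace U)) (ideal_of (veronese_variety d)))
    (veronese d p) <-> (val (veronese d p) <= U)%VS.
Proof.
rewrite points_scheme_inter; try exact: ideal_of0.
split=> [[/points_linear_subspace]//|pU].
split; first exact/points_linear_subspace.
by apply: points_ideal_of; exists p.
Qed.

Theorem proposition3p10 (R : realType) (F : dhomog 3 R[i] 6) :
  let P3F : {vspace dhomog 3 R[i] 3} := limg (catalecticant 3 F) in
  let Y := scheme_inter (ideal_of (linear_subspace P3F))
                        (ideal_of (veronese_variety 3)) in
  projdim P3F = 7 ->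
  finite_scheme Y ->
  reduced_scheme Y ->
  waring_rank F 9 ->
  (exists A : {fset 'P(dhomog 3 R[i] 1)},
     (forall p, p \in A <-> points Y (veronese 3 p)) /\
     unique (fun B => decomposition F B /\ #|` B| = 9%N) A) /\
  identifiable F.
Proof.
move=> P3F Y dP [S finS] _ rF.
have {}dP : \dim P3F = 8%N.
  by move: dP; rewrite /projdim => /eqP; rewrite subr_eq => /eqP[].
have finP p : (val (veronese 3 p) <= P3F)%VS -> veronese 3 p \in S.
  by move=> pP; apply/finS/points_inter_veronese.
have [[A [FA cA]] _] := rF.
have sub B := @decomposition_in_base_locus _ F B dP rF.
have AP p : p \in A <-> (val (veronese 3 p) <= P3F)%VS.
  split=> [pA|pP]; first exact: sub FA cA p pA.
  apply/negPn/negP => pA; have := base_points_le9 (ps := p :: A) dP finP.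
  (* [A] and [p] together would be 10 base points. *)
  rewrite /= pA fset_uniq -cA ltnn => /(_ isT) h.
  suff: false by []. apply: h => q; rewrite inE => /predU1P[->//|].
  exact: sub.
have uniqA : unique (fun B => decomposition F B /\ #|` B| = 9%N) A.
  split=> // B [FB cB]; apply/esym/eqP; rewrite eqEfcard cA cB leqnn andbT.
  by apply/fsubsetP => p /(sub B FB cB) /AP.
split.
  exists A; split=> // p; rewrite AP.
  exact: iff_sym (points_inter_veronese _ _).
by exists 9%N; split=> //; exists A.
Qed.
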